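(* There is an absolute constant $c>0$ such that the following holds. Let $G=(V,E,w)$ be an undirected graph with $n=|V|$ vertices and nonnegative edge weights, let $\{p_e\}_{e\in E}\subseteq[0,1]$ be predictions, and let $C^*\subseteq E$ be a minimum cut of $G$, with respect to which $\eta$ and $\rho$ are defined (as in the context), where $\rho\ge 1$. Then for a suitable setting of the parameters $B$ and $t$ (which may depend on $n,\eta,\rho$), the Boosted Karger's algorithm outputs a minimum cut of $G$ with probability at least $$\frac{c}{n^{2\eta}\rho^{2(1-\eta)}}.$$
   Context: For $E'\subseteq E$, $w(E')=\sum_{e\in E'}w(e)$. A cut is the set of edges crossing a partition $(S,V\setminus S)$ of $V$ with both parts nonempty; a minimum cut minimizes total weight. Given predictions $p_e\in[0,1]$ (interpreted as a predicted likelihood that $e\in C^*$), define $$\eta:=\frac{\sum_{e\in C^*}(1-p_e)w(e)}{w(C^* )},\qquad \rho:=\frac{\sum_{e\in E\setminus C^*}p_e w(e)}{w(C^* )}.$$ Contracting an edge merges its two endpoints into a single (meta)vertex, deleting the resulting self-loops and keeping parallel edges (each remaining edge is an edge of the original graph); each metavertex corresponds to a subset of $V$. Boosted Karger's algorithm with parameters $B$ (scalar) and $t$ (threshold): set $w_B(e)=(1+(B-1)(1-p_e))w(e)$. Phase 1: while more than $t$ vertices remain, pick a remaining edge $\bar e$ with probability $w_B(\bar e)/\sum_{e}w_B(e)$ (sum over remaining edges) and contract it. Phase 2: on the resulting graph with original weights $w$, while at least 3 vertices remain, pick a remaining edge $\bar e$ with probability $w(\bar e)/\sum_e w(e)$ and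 contract it. Output the set of edges of $G$ between the two final metavertices. *)

(* Defs.v *)
From mathcomp Require Export all_boot all_order all_algebra.
From mathcomp Require Export reals exp.

Set Implicit Arguments.
Unset Strict Implicit.
Unset Printing Implicit Defensive.

Import Order.TTheory GRing.Theory Num.Theory.
Local Open Scope ring_scope.

(* The type does not enforce nonnegativity or total mass 1; the distributions
   built below have both whenever the weights are nonnegative and every
   normalizing total is nonzero. *)
Section Dist.
Variable R : realType.

Definition dist (T : finType) := {ffun T -> R}.

Definition dret (T : finType) (x : T) : dist T := [ffun y => (y == x)%:R].

Definition dbind (T U : finType) (m : dist T) (f : T -> dist U) : dist U :=
  [ffun y => \sum_x m x * f x y].

Definition prob (T : finType) (m : dist T) (A : pred T) : R :=
  \sum_(x | A x) m x.

End Dist.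

Section Karger.
Variable R : realType.
(* A loopless undirected multigraph: an edge e joins the two elements of
   ends e, and distinct edges may be parallel. *)
Variables (V E : finType) (ends : E -> {set V}).

Definition loopless : Prop := forall e, #|ends e| = 2%N.

Definition total (w : E -> R) (F : {set E}) : R := \sum_(e in F) w e.

Definition crossing (S : {set V}) : {set E} :=
  [set e | (ends e :&: S != set0) && (ends e :&: ~: S != set0)].

Definition is_cut (C : {set E}) : bool :=
  [exists S : {set V}, [&& S != set0, ~: S != set0 & C == crossing S]].

Definition is_min_cut (w : E -> R) (C : {set E}) : bool :=
  is_cut C && [forall D : {set E}, is_cut D ==> (total w C <= total w D)].

(* If total w C = 0 these quotients are 0 by the convention x / 0 = 0; hence
   1 <= pred_rho w p C forces total w C != 0. *)
Definition pred_eta (w p : E -> R) (C : {set E}) : R :=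
  (\sum_(e in C) (1 - p e) * w e) / total w C.

Definition pred_rho (w p : E -> R) (C : {set E}) : R :=
  (\sum_(e in ~: C) p e * w e) / total w C.

(* A contracted graph is represented by the partition of V into metavertices;
   its edges are the edges of the original graph that are not self-loops. *)
Definition remaining (P : {set {set V}}) : {set E} :=
  [set e | ~~ [exists S in P, ends e \subset S]].

Definition singletons : {set {set V}} := [set [set v] | v : V].

Definition contract (P : {set {set V}}) (e : E) : {set {set V}} :=
  let M := [set S in P | S :&: ends e != set0] in
  cover M |: (P :\: M).

(* Mass is lost (so that the run counts as a failure) when total w F = 0. *)
Definition pick_edge (w : E -> R) (F : {set E}) : dist R E :=
  [ffun e => if e \in F then w e / total w F else 0].

Definition contract_step (w : E -> R) (P : {set {set V}}) :
    dist R {set {set V}} :=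
  dbind (pick_edge w (remaining P)) (fun e => dret R (contract P e)).

(* k is fuel. *)
Fixpoint contract_while (w : E -> R) (t k : nat) (P : {set {set V}}) :
    dist R {set {set V}} :=
  if k is k'.+1 then
    if (t < #|P|)%N then dbind (contract_step w P) (contract_while w t k')
    else dret R P
  else dret R P.

(* Each contraction removes one metavertex, so #|V| iterations suffice for
   the loop to terminate. *)
Definition contract_to (w : E -> R) (t : nat) (P : {set {set V}}) :
    dist R {set {set V}} := contract_while w t #|V| P.

Definition boosted (B : R) (w p : E -> R) (e : E) : R :=
  (1 + (B - 1) * (1 - p e)) * w e.

(* The distribution of the returned edge set; once two metavertices are left,
   the remaining edges are exactly those between them. *)
Definition boosted_karger (w p : E -> R) (B : R) (t : nat) : dist R {set E} :=
  dbind (contract_to (boosted B w p) t singletons) (fun P =>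
  dbind (contract_to w 2 P) (fun Q =>
  dret R (remaining Q))).

End Karger.

(* Main.v *)
(** Every metavertex bounds a cut, so a contracted graph on m metavertices has
    total weight at least m w(C)/2, where C is the given minimum cut.  With
    B = n + 1 this gives total boosted weight at least n w(C) (m/2 - 1 - rho),
    while C has boosted weight n w(C) (eta + 1/n).  Hence a Phase 1 contraction
    hits C with probability at most s / (m - 2 rho - 2), s = 2 (eta + 1/n).
    With t about 3 rho + 6 and d = 2 rho + 5, the inequality
    1 - s/x >= ((y - 1)/y)^s for x >= y + s makes the survival probability
    telescope to at least ((t - d)/(n - d))^s >= (rho/n)^s, and n^(2/n) <= 4.
    Phase 2 succeeds with probability at least 2/(t (t - 1)), of order
    rho^(-2). *)
Require Import Defs.
From mathcomp Require Import sequences lra ring.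
Import Order.TTheory GRing.Theory Num.Theory.
Local Open Scope ring_scope.

Set Implicit Arguments.
Unset Strict Implicit.
Unset Printing Implicit Defensive.

(** * Expectations under finite distributions *)

Section Expectation.
Variable R : realType.

(** General test functions, not only events, let the phases be composed: the success probability of
    Phase 2 serves as the test function at the end of Phase 1. *)
Definition expect (T : finType) (m : dist R T) (h : T -> R) : R :=
  \sum_x m x * h x.

Lemma prob_expect (T : finType) (m : dist R T) (A : pred T) :
  prob m A = expect m (fun x => (A x)%:R).
Proof.
rewrite /prob /expect big_mkcond; apply: eq_bigr => x _.
by case: (A x); rewrite ?mulr1 ?mulr0.
Qed.

Lemma expect_dret (T : finType) (x : T) (h : T -> R) :
  expect (dret R x) h = h x.
Proof.
rewrite /expect (bigD1 x) //= ffunE eqxx mul1r big1 ?addr0 // => y /negPf yx.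
by rewrite ffunE yx mul0r.
Qed.

Lemma expect_dbind (T U : finType) (m : dist R T) (f : T -> dist R U)
    (h : U -> R) :
  expect (dbind m f) h = expect m (fun x => expect (f x) h).
Proof.
rewrite /expect; under eq_bigr do rewrite ffunE mulr_suml.
rewrite exchange_big /=; apply: eq_bigr => x _.
by rewrite mulr_sumr; apply: eq_bigr => y _; rewrite mulrA.
Qed.

End Expectation.

(** * Contraction of vertex partitions and the weight of contracted graphs *)

Section Contraction.
Variables (R : realType) (V E : finType) (ends : E -> {set V}).
Hypothesis loopless_ends : loopless ends.

Local Notation remaining := (remaining ends).
Local Notation contract := (contract ends).
Local Notation crossing := (crossing ends).

Lemma total_split (w : E -> R) (F C : {set E}) : C \subset F ->
  total w F = total w C + total w (F :\: C).
Proof. by move=> CF; rewrite /total (big_setID C) /= (setIidPr CF). Qed.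

Lemma total_ge0 (w : E -> R) (F : {set E}) :
  (forall e, 0 <= w e) -> 0 <= total w F.
Proof. by move=> w0; apply: sumr_ge0. Qed.

Section Partition.
Variable P : {set {set V}}.
Hypothesis partP : partition P setT.

Let trivP : trivIset P. Proof. by case/and3P: partP. Qed.

Let in_cover v : v \in cover P.
Proof. by rewrite (cover_partition partP). Qed.

Lemma meeting_blocks e u v : ends e = [set u; v] ->
  [set A in P | A :&: ends e != set0] = [set pblock P u; pblock P v].
Proof.
move=> euv; apply/setP => A; rewrite !inE; apply/andP/orP.
  case=> AP /set0Pn[x]; rewrite inE euv !inE => /andP[xA /orP[]/eqP xE];
  rewrite -xE; [left|right]; by rewrite (def_pblock trivP AP xA).
by case=> /eqP->; (split; first exact: pblock_mem); apply/set0Pn;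
  [exists u|exists v]; rewrite inE mem_pblock in_cover euv !inE eqxx ?orbT.
Qed.

Lemma remaining_ends e : e \in remaining P ->
  exists u v, [/\ ends e = [set u; v] & pblock P u != pblock P v].
Proof.
rewrite inE => /existsP erem; have /eqP/cards2P[u [v [_ euv]]] := loopless_ends e.
exists u, v; split=> //; apply/eqP => uv; apply: erem; exists (pblock P u).
rewrite pblock_mem //= euv; apply/subsetP => x; rewrite !inE => /orP[]/eqP->.
  by rewrite mem_pblock.
by rewrite uv mem_pblock.
Qed.

(** This makes the merged block a new one, so that a contraction lowers the number of blocks by
    exactly one. If the union of the two blocks were already a block, it would be the block of [u],
    which is among those removed. *)
Lemma cover_meeting e : e \in remaining P ->
  cover [set A in P | A :&: ends e != set0] \notin
  P :\: [set A in P | A :&: ends e != set0].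
Proof.
move=> /remaining_ends[u [v [euv uv]]].
rewrite (meeting_blocks euv) inE negb_and negbK; case: (boolP (_ \in P)) => [cP|].
  rewrite orbF; suff -> : cover [set pblock P u; pblock P v] = pblock P u by
    rewrite !inE eqxx.
  apply/esym/(def_pblock trivP cP)/bigcupP; exists (pblock P u).
    by rewrite !inE eqxx.
  by rewrite mem_pblock.
by rewrite orbT.
Qed.

Lemma card_contract e : e \in remaining P -> #|contract P e|.+1 = #|P|.
Proof.
move=> erem; rewrite /Defs.contract cardsU1 cover_meeting //.
have [u [v [euv uv]]] := remaining_ends erem.
rewrite -(cardsID [set A in P | A :&: ends e != set0] P).
suff -> : P :&: [set A in P | A :&: ends e != set0] =
          [set pblock P u; pblock P v] by rewrite cards2 uv.
rewrite -(meeting_blocks euv); apply/setIidPr/subsetP => A.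
by rewrite inE => /andP[].
Qed.

Lemma contract_partition e : e \in remaining P -> partition (contract P e) setT.
Proof.
move=> erem; rewrite /Defs.contract.
set M := [set A in P | _]; have MP : M \subset P.
  by apply/subsetP => A; rewrite inE => /andP[].
have [u [v [euv uv]]] := remaining_ends erem.
have P0 : set0 \notin P by case/and3P: partP.
have disjM : {in P :\: M, forall B : {set V}, [disjoint cover M & B]}.
  move=> B /setDP[BP BM]; rewrite disjoint_sym; apply/bigcup_disjointP => A AM.
  apply: (trivIsetP trivP) => //; first exact: (subsetP MP).
  by apply: contraNneq BM => ->.
have [] := trivIsetU1 disjM (trivIsetS (subsetDl P M) trivP) _.
  by rewrite inE negb_and P0 orbT.
move=> trivQ _; apply/and3P; split=> //.
  rewrite eqEsubset subsetT; apply/subsetP => x _; apply/bigcupP.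
  case: (boolP (pblock P x \in M)) => xM.
    exists (cover M); first by rewrite !inE eqxx.
    by apply/bigcupP; exists (pblock P x) => //; rewrite mem_pblock.
  exists (pblock P x); last by rewrite mem_pblock.
  by rewrite in_setU1 in_setD xM pblock_mem ?orbT.
rewrite !inE (negPf P0) andbF orbF eq_sym; apply/set0Pn; exists u.
apply/bigcupP; exists (pblock P u); last by rewrite mem_pblock.
by rewrite /M (meeting_blocks euv) !inE eqxx.
Qed.

(** An edge inside a block crosses no block, and a remaining edge can cross only the blocks of its
    two endpoints; doubling the boolean covers both cases. *)
Lemma card_crossed_blocks e :
  (#|[set A in P | e \in crossing A]| <= (e \in remaining P).*2)%N.
Proof.
case: (boolP (e \in remaining P)) => [/remaining_ends[u [v [euv _]]]|].
  apply: leq_trans (_ : #|[set pblock P u; pblock P v]| <= _)%N; last first.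
    by rewrite cards2; case: (_ != _).
  rewrite -(meeting_blocks euv) subset_leq_card //; apply/subsetP => A.
  by rewrite !inE [A :&: _]setIC => /and3P[-> -> _].
rewrite inE negbK => /existsP[A /andP[AP eA]].
rewrite leqn0 cards_eq0; apply/eqP/setP => B; rewrite !inE.
apply/negbTE/negP => /and3P[BP /set0Pn[x]].
rewrite inE => /andP[xe xB] /set0Pn[y]; rewrite !inE => /andP[ye].
rewrite -(def_pblock trivP BP xB) (def_pblock trivP AP (subsetP eA _ xe)).
by rewrite (subsetP eA).
Qed.

(** Double counting: exchanging the sums counts, for each edge, the blocks that it crosses. *)
Lemma handshake (w : E -> R) : (forall e, 0 <= w e) ->
  \sum_(A in P) total w (crossing A) <= 2 * total w (remaining P).
Proof.
move=> w0; rewrite /total mulr_sumr.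
under eq_bigr do rewrite big_mkcond.
rewrite exchange_big /= [leRHS]big_mkcond /=; apply: ler_sum => e _.
rewrite -big_mkcondr /= sumr_const.
have := card_crossed_blocks e.
rewrite cardsE => h; have -> : (if e \in remaining P then 2 * w e else 0) =
  w e *+ (e \in remaining P).*2 by case: ifP => _ //=; rewrite ?mulr0n // mulr_natl.
by rewrite ler_wpMn2l.
Qed.

Lemma min_cut_remaining (w : E -> R) (C : {set E}) :
  (forall e, 0 <= w e) -> is_min_cut ends w C -> (1 < #|P|)%N ->
  #|P|%:R * total w C <= 2 * total w (remaining P).
Proof.
move=> w0 /andP[_ /forallP minC] P1; apply: le_trans (handshake w0).
rewrite mulr_natl -sumr_const; apply: ler_sum => A AP.
apply: (implyP (minC _)); apply/existsP; exists A; rewrite eqxx andbT.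
have /and3P[_ _ P0] := partP; apply/andP; split.
  by apply: contraNneq P0 => <-.
(* A second block, disjoint from [A], supplies a vertex of the complement. *)
apply/set0Pn; have := P1; rewrite (cardsD1 A) AP ltnS card_gt0 => /set0Pn[B].
rewrite !inE => /andP[BA BP]; have /set0Pn[x xB] : B != set0.
  by apply: contraNneq P0 => <-.
exists x; rewrite inE; apply: contra BA => xA.
by rewrite -(def_pblock trivP BP xB) (def_pblock trivP AP xA).
Qed.

End Partition.

(** * Runs that never contract an edge of a fixed cut *)

Section Invariant.
Variable S : {set V}.

(** The invariant of a run that has contracted no edge of the cut: no metavertex straddles its two
    sides. *)
Definition compatible (P : {set {set V}}) : Prop :=
  partition P setT /\ {in P, forall A : {set V}, (A \subset S) || (A \subset ~: S)}.

Lemma compatible_remaining P : compatible P -> crossing S \subset remaining P.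
Proof.
move=> [partP PS]; apply/subsetP => e; rewrite !inE.
case/andP=> /set0Pn[x /setIP[xe xS]] /set0Pn[y /setIP[ye]]; rewrite inE => yS.
apply/existsP => -[A /andP[AP eA]]; case/orP: (PS A AP) => /subsetP AS.
  by rewrite AS ?(subsetP eA) in yS.
by have := AS x; rewrite inE xS (subsetP eA) // => /(_ isT).
Qed.

(** Both endpoints of an edge outside the cut lie on the same side, hence so do the two blocks that
    are merged. *)
Lemma compatible_contract P e : compatible P ->
  e \in remaining P :\: crossing S -> compatible (contract P e).
Proof.
move=> [partP PS] /setDP[erem eS]; split; first exact: contract_partition.
have [u [v [euv uv]]] := remaining_ends partP erem.
move=> A; rewrite !inE => /orP[/eqP->|/andP[_ /PS //]].
rewrite (meeting_blocks partP euv).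
have side x (T : {set V}) : x \in T ->
    {in P, forall A : {set V}, (A \subset T) || (A \subset ~: T)} ->
    pblock P x \subset T.
  move=> xT PT; have xP : x \in cover P by rewrite (cover_partition partP).
  case/orP: (PT _ (pblock_mem xP)) => [//|/subsetP h].
  by have := h x; rewrite mem_pblock xP inE xT => /(_ isT).
have PS' : {in P, forall A : {set V}, (A \subset ~: S) || (A \subset ~: ~: S)}.
  by move=> B /PS; rewrite setCK orbC.
have uvS : (u \in S) = (v \in S).
  apply/idP/idP; apply: contraLR => vS; move: eS; rewrite inE negb_and !negbK.
    apply: contraL => uS; rewrite negb_or; apply/andP; split; apply/set0Pn.
      by exists u; rewrite euv !inE eqxx.
    by exists v; rewrite euv !inE eqxx orbT.
  apply: contraL => uS; rewrite negb_or; apply/andP; split; apply/set0Pn.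
    by exists v; rewrite euv !inE eqxx orbT.
  by exists u; rewrite euv !inE eqxx.
case: (boolP (u \in S)) => uS; apply/orP; [left|right];
  apply/bigcupsP => B; rewrite !inE => /orP[]/eqP->; apply: side => //.
- by rewrite -uvS.
- by rewrite inE.
- by rewrite inE -uvS.
Qed.

Lemma compatible_singletons : compatible (singletons V).
Proof.
split; last first.
  move=> A /imsetP[v _ ->]; rewrite !sub1set inE; by case: (v \in S).
apply/and3P; split.
- rewrite eqEsubset subsetT; apply/subsetP => v _; apply/bigcupP.
  by exists [set v]; rewrite ?inE // imset_f.
- apply/trivIsetP => _ _ /imsetP[u _ ->] /imsetP[v _ ->] uv.
  by rewrite disjoints1 inE; apply: contraNneq uv => ->.
- by apply/imsetP => -[v _ /setP/(_ v)]; rewrite !inE eqxx.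
Qed.

Lemma card_singletons : #|singletons V| = #|V|.
Proof. by rewrite card_imset //; exact: set1_inj. Qed.

Hypotheses (S0 : S != set0) (CS0 : ~: S != set0).

Lemma compatible_card P : compatible P -> (1 < #|P|)%N.
Proof.
move=> [partP PS]; have /set0Pn[x xS] := S0; have /set0Pn[y] := CS0.
rewrite inE => yS; have inP z : z \in cover P by rewrite (cover_partition partP).
rewrite (cardsD1 (pblock P x)) (cardsD1 (pblock P y)) pblock_mem // !inE.
suff -> : pblock P y != pblock P x by rewrite pblock_mem.
apply/eqP => yx; case/orP: (PS _ (pblock_mem (inP x))) => /subsetP h.
  by have := h y; rewrite -yx mem_pblock inP (negPf yS) => /(_ isT).
by have := h x; rewrite mem_pblock inP inE xS => /(_ isT).
Qed.

(** Contracting a remaining edge outside the cut would give a compatible partition with a single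
    block, but a compatible partition has a block on each side. *)
Lemma compatible_final P : compatible P -> (#|P| <= 2)%N ->
  remaining P = crossing S.
Proof.
move=> cP P2; have P2' : #|P| == 2%N by rewrite eqn_leq P2 compatible_card.
have [partP PS] := cP; have /and3P[_ trivP _] := partP.
apply/eqP; rewrite eq_sym eqEsubset compatible_remaining //=.
apply/subsetP => e erem; have [u [v [euv uv]]] := remaining_ends partP erem.
have inP z : z \in cover P by rewrite (cover_partition partP).
apply: contraT => eS.
have cQ : compatible (contract P e).
  by apply: compatible_contract => //; rewrite inE eS.
have := compatible_card cQ; rewrite -ltnS (card_contract partP erem).
by rewrite ltnNge P2.
Qed.

Lemma expect_contract_while_ge0 (w : E -> R) t k P (h : {set {set V}} -> R) :
  (forall e, 0 <= w e) -> (forall Q, 0 <= h Q) ->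
  0 <= expect (contract_while ends w t k P) h.
Proof.
move=> w0 h0; elim: k P => [|k IHk] P /=; first by rewrite expect_dret.
case: ifP => _; last by rewrite expect_dret.
rewrite !expect_dbind; apply: sumr_ge0 => e _; rewrite expect_dret mulr_ge0 //.
by rewrite ffunE; case: ifP => _ //; rewrite divr_ge0 ?total_ge0.
Qed.

(** The common induction for both phases: [f] is a lower bound that depends only on the number of
    metavertices, and it need only satisfy the recurrence given by the chance of missing the cut.
    Positive total weight ensures that no mass is lost, and the bound on [#|P|] that the fuel
    suffices. *)
Lemma expect_contract_while_ge (w : E -> R) t k P (h : {set {set V}} -> R)
    (f : nat -> R) :
  (forall e, 0 <= w e) -> (forall Q, 0 <= h Q) ->
  (forall Q, compatible Q -> (#|Q| <= t)%N -> f #|Q| <= h Q) ->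
  (forall Q, compatible Q -> (t < #|Q|)%N ->
     f #|Q| <= (1 - total w (crossing S) / total w (remaining Q)) * f #|Q|.-1
     /\ 0 < total w (remaining Q)) ->
  compatible P -> (#|P| <= t + k)%N ->
  f #|P| <= expect (contract_while ends w t k P) h.
Proof.
move=> w0 h0 fh fS; elim: k P => [|k IHk] P cP /=.
  by rewrite addn0 expect_dret; exact: fh.
move=> Pk; case: ltnP => Pt; last by rewrite expect_dret; exact: fh.
rewrite !expect_dbind; have [] := fS P cP Pt.
set T := total w (remaining P) => fP T0; apply: le_trans fP _.
(* The chance of missing the cut is the sum of the pick probabilities of the edges outside it. *)
have -> : 1 - total w (crossing S) / T =
          \sum_(e in remaining P :\: crossing S) w e / T.
  rewrite -mulr_suml -[X in X - _](divff (lt0r_neq0 T0)) -mulrBl.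
  rewrite [in X in X - _]/T (total_split _ (compatible_remaining cP)).
  by rewrite addrC addKr.
(* Compare edge by edge; picks of cut edges are bounded below by 0. *)
rewrite mulr_suml big_mkcond; apply: ler_sum => e _.
rewrite expect_dret ffunE -/T; case: ifP => [eD|_]; last first.
  apply: mulr_ge0; last exact: expect_contract_while_ge0.
  by case: ifP => _ //; rewrite divr_ge0 // ltW.
have [partP _] := cP; have /setDP[erem _] := eD; rewrite erem.
have cardP := card_contract partP erem.
rewrite ler_wpM2l ?divr_ge0 ?(ltW T0) //.
have -> : #|P|.-1 = #|contract P e| by rewrite -cardP.
apply: IHk; first exact: compatible_contract.
by rewrite -ltnS cardP -addnS.
Qed.

End Invariant.
End Contraction.

(** * Real inequalities for the success bounds *)

Section Analysis.
Variable R : realType.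

(** Pass through the exponential: 1 - 1/y <= exp(-1/y), and exp(-s/y) <= 1/(1 + s/y) = 1 - s/(y +
    s). This is where the shift by [s] comes from. *)
Lemma powR_step (s x y : R) : 0 <= s -> 1 <= y -> y + s <= x ->
  ((y - 1) / y) `^ s <= 1 - s / x.
Proof.
move=> s0 y1 yx; have y0 : 0 < y by lra.
apply: le_trans (_ : expR (- (s / y)) <= _).
  rewrite (_ : - (s / y) = - y^-1 * s); last by rewrite mulNr mulrC.
  rewrite expRM; apply: ge0_ler_powR => //; rewrite ?nnegrE ?expR_ge0 //.
    by apply: divr_ge0; lra.
  by rewrite mulrBl divff ?lt0r_neq0 // mul1r expR_ge1Dx.
rewrite expRN; apply: le_trans (_ : (1 + s / y)^-1 <= _).
  by rewrite lef_pV2 ?posrE ?expR_gt0 ?expR_ge1Dx // ltr_wpDr // divr_ge0 // ltW.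
have ys : 0 < y + s by lra.
have -> : (1 + s / y)^-1 = 1 - s / (y + s).
  by field; rewrite !lt0r_neq0.
by rewrite lerD2l lerN2 ler_wpM2l // lef_pV2 ?posrE //; lra.
Qed.

(** The inverse of the binomial coefficient m choose 2, as in the classical analysis of Karger's
    algorithm. *)
Definition karger_bound (m : nat) : R := 2 / (m%:R * (m%:R - 1)).

Lemma karger_bound_ge0 m : (1 <= m)%N -> 0 <= karger_bound m.
Proof.
by move=> m1; rewrite divr_ge0 // mulr_ge0 // subr_ge0 (ler_nat _ 1).
Qed.

Lemma karger_boundS m : (2 < m)%N ->
  karger_bound m = (1 - 2 / m%:R) * karger_bound m.-1.
Proof.
case: m => // m m2; rewrite /karger_bound /= -natr1.
have : 2 <= m%:R :> R by rewrite ler_nat.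
by move=> ?; field; do ![apply/andP; split]; apply: lt0r_neq0; lra.
Qed.

(** Above the threshold, the power is the telescoped product of the factors ((y - 1)/y)^s for y = j
    - d, with j from t + 1 to m; [karger_bound t] accounts for Phase 2. *)
Definition boosted_bound (t : nat) (s d : R) (m : nat) : R :=
  if (m <= t)%N then karger_bound m
  else karger_bound t * ((t%:R - d) / (m%:R - d)) `^ s.

Lemma boosted_boundS t s d m x : (1 <= t)%N -> 0 <= s -> d + 1 <= t%:R ->
  (t < m)%N -> m%:R - d + s <= x ->
  boosted_bound t s d m <= (1 - s / x) * boosted_bound t s d m.-1.
Proof.
case: m => // m t1 s0 dt; rewrite ltnS => tm mx.
have tmR : t%:R <= m%:R :> R by rewrite ler_nat.
have {mx} mx : m%:R + 1 - d + s <= x by move: mx; rewrite -natr1.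
have t0 : 0 < t%:R - d by lra.
have m0 : 0 < m%:R - d by lra.
have m1 : 0 < m%:R + 1 - d by lra.
rewrite /boosted_bound /= ltnNge tm /= -natr1.
set K := karger_bound t; have K0 : 0 <= K by exact: karger_bound_ge0.
(* The two branches agree at m = t, where the ratio is 1. *)
have -> : (if (m <= t)%N then karger_bound m
           else K * ((t%:R - d) / (m%:R - d)) `^ s) =
          K * ((t%:R - d) / (m%:R - d)) `^ s.
  case: leqP => // mt; have -> : m = t by apply/eqP; rewrite eqn_leq mt.
  by rewrite divff ?lt0r_neq0 // powR1 mulr1.
rewrite mulrCA ler_wpM2l //.
have -> : (t%:R - d) / (m%:R + 1 - d) =
    ((m%:R + 1 - d - 1) / (m%:R + 1 - d)) * ((t%:R - d) / (m%:R - d)).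
  by field; rewrite !lt0r_neq0 //; lra.
rewrite powRM; [|by apply: divr_ge0; lra..].
by rewrite ler_wpM2r ?powR_ge0 //; apply: powR_step => //; lra.
Qed.

(** Since rho >= 1, t <= 3 rho + 6 <= 9 rho. Phase 2 thus contributes 2/(81 rho^2), and n^(2/n)
    costs a factor of at most 4, whence 162 = 81 * 4 / 2. *)
Lemma boosted_bound_ge (n t : nat) (eta rho : R) :
  (2 <= n)%N -> 1 <= rho -> 0 <= eta <= 1 ->
  3 * rho + 5 <= t%:R <= 3 * rho + 6 ->
  162^-1 / (n%:R `^ (2 * eta) * rho `^ (2 * (1 - eta))) <=
  boosted_bound t (2 * (eta + n%:R^-1)) (2 * rho + 5) n.
Proof.
move=> n2 r1 /andP[e0 e1] /andP[t5 t6].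
have nR : 2 <= n%:R :> R by rewrite ler_nat.
have n0 : 0 < n%:R :> R by lra.
have r0 : 0 < rho by lra.
have kb (m : nat) (u : R) : (2 <= m)%N -> m%:R <= u -> 2 / u ^+ 2 <= karger_bound m.
  move=> m2 mu; have mR : 2 <= m%:R :> R by rewrite ler_nat.
  rewrite /karger_bound ler_wpM2l // lef_pV2 ?posrE; [|nra..].
  by nra.
(* If n <= t, Phase 1 is empty and n <= 9 rho, so part of the factor n^2 can be traded for a power
   of rho. *)
rewrite /boosted_bound; case: leqP => [nt|tn].
  have nt' : n%:R <= t%:R :> R by rewrite ler_nat.
  apply: le_trans (kb n n%:R n2 (lexx _)).
  have -> : n%:R ^+ 2 = n%:R `^ (2 * eta) * n%:R `^ (2 * (1 - eta)) :> R.
    rewrite -powRD; last by rewrite lt0r_neq0 // implybT.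
    by rewrite -powR_mulrn ?ltW //; congr (_ `^ _); ring.
  have h : n%:R `^ (2 * (1 - eta)) <= 81 * rho `^ (2 * (1 - eta)).
    apply: le_trans (_ : (9 * rho) `^ (2 * (1 - eta)) <= _).
      by apply: ge0_ler_powR; rewrite ?nnegrE; lra.
    rewrite powRM; [|lra..]; rewrite ler_wpM2r ?powR_ge0 //.
    apply: le_trans (_ : 9 `^ 2%:R <= _); first by apply: ler_powR; lra.
    by rewrite powR_mulrn //; lra.
  have A0 := powR_gt0 (2 * eta) n0; have B0 := powR_gt0 (2 * (1 - eta)) n0.
  have C0 := powR_gt0 (2 * (1 - eta)) r0.
  rewrite ler_pdivrMr; last exact: mulr_gt0.
  rewrite mulrAC ler_pdivlMr; last exact: mulr_gt0.
  by nra.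
have n2' : (2 <= t)%N by rewrite -(ler_nat R); lra.
have tnR : t%:R <= n%:R :> R by rewrite ler_nat ltnW.
set s := 2 * (eta + _).
have s0 : 0 <= s by rewrite mulr_ge0 // addr_ge0 // invr_ge0 ltW.
have nV0 : 0 <= n%:R^-1 :> R by rewrite invr_ge0 ltW.
(* From n <= 2^n. *)
have npow : n%:R `^ (2 * n%:R^-1) <= 4 :> R.
  have -> : 4 = (2 ^+ n) `^ (2 * n%:R^-1) :> R.
    rewrite -powR_mulrn // -powRrM mulrCA divff ?lt0r_neq0 // mulr1.
    by rewrite powR_mulrn // expr2; lra.
  apply: ge0_ler_powR; rewrite ?nnegrE ?mulr_ge0 ?exprn_ge0 //.
  by rewrite -natrX ler_nat ltnW // ltn_expl.
(* The lower bound on t leaves t - d >= rho for d = 2 rho + 5. *)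
have ratio : rho / n%:R <= (t%:R - (2 * rho + 5)) / (n%:R - (2 * rho + 5)).
  apply: ler_pM; [lra|by []|lra|].
  by rewrite lef_pV2 ?posrE; lra.
have Ktb : 2 / (9 * rho) ^+ 2 <= karger_bound t by apply: kb => //; lra.
apply: le_trans (_ : 2 / (9 * rho) ^+ 2 * (rho / n%:R) `^ s <= _); last first.
  apply: ler_pM; rewrite ?powR_ge0 ?divr_ge0 ?exprn_ge0 //; first lra.
  have q0 : 0 <= rho / n%:R by rewrite divr_ge0 // ltW.
  by apply: ge0_ler_powR => //; rewrite nnegrE //; apply: le_trans ratio.
have -> : (rho / n%:R) `^ s = rho `^ s / n%:R `^ s.
  rewrite powRM ?(ltW r0) ?invr_ge0 ?(ltW n0) //.
  by rewrite -(powR_inv1 (ltW n0)) -powRrM mulN1r powRN.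
(* The excess 2/n in the exponent is harmless on the base rho >= 1. *)
have rs : rho `^ (2 * eta) <= rho `^ s by apply: ler_powR => //; rewrite /s; lra.
have -> : n%:R `^ s = n%:R `^ (2 * eta) * n%:R `^ (2 * n%:R^-1).
  by rewrite -powRD ?lt0r_neq0 ?implybT // /s mulrDr.
have -> : rho `^ (2 * (1 - eta)) = rho ^+ 2 / rho `^ (2 * eta).
  rewrite -powR_mulrn ?ltW // -powRB; last by rewrite lt0r_neq0 ?implybT.
  by congr (_ `^ _); ring.
have A0 := powR_gt0 (2 * eta) n0; have B0 := powR_gt0 (2 * n%:R^-1) n0.
have C0 := powR_gt0 (2 * eta) r0.
set a := n%:R `^ (2 * eta) in A0 *; set b := n%:R `^ _ in npow B0 *.
set c := rho `^ (2 * eta) in rs C0 *; set e := rho `^ s in rs *.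
have -> : 162^-1 / (a * (rho ^+ 2 / c)) = 2 / (9 * rho) ^+ 2 * (c / (a * 4)).
  by field; rewrite !lt0r_neq0.
rewrite ler_wpM2l ?divr_ge0 ?exprn_ge0 //; first lra.
apply: ler_pM; rewrite ?invr_ge0 ?mulr_ge0 ?(ltW A0) ?(ltW C0) //.
by rewrite lef_pV2 ?posrE ?mulr_gt0 // ler_wpM2l // ltW.
Qed.

End Analysis.

(** * Success probabilities of the two phases *)

Section BoostedKarger.
Variables (R : realType) (V E : finType) (ends : E -> {set V}).
Variables (w p : E -> R) (S : {set V}).
Hypothesis loopless_ends : loopless ends.
Hypothesis w_ge0 : forall e, 0 <= w e.
Hypothesis p01 : forall e, 0 <= p e <= 1.
Hypotheses (S0 : S != set0) (CS0 : ~: S != set0).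

Local Notation C := (crossing ends S).
Hypothesis minC : is_min_cut ends w C.
Hypothesis C_gt0 : 0 < total w C.

Local Notation eta := (pred_eta w p C).
Local Notation rho := (pred_rho w p C).

Lemma compatible_card_le P : compatible S P -> (#|P| <= #|V|)%N.
Proof.
move=> [partP _]; rewrite -cardsT (card_partition partP) -sum1_card.
by apply: leq_sum => A AP; rewrite card_gt0 (partition_neq0 partP AP).
Qed.

(** With m metavertices the cut carries at most a fraction 2/m of the remaining weight, which is the
    factor in [karger_boundS]. *)
Lemma karger_success P : compatible S P ->
  karger_bound R #|P| <=
  expect (contract_to ends w 2 P)
         (fun Q => (is_min_cut ends w (remaining ends Q))%:R).
Proof.
move=> cP; apply: (expect_contract_while_ge loopless_ends) (cP) _ => //.
- move=> Q cQ Q2; rewrite (compatible_final loopless_ends S0 CS0 cQ Q2) minC.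
  have -> : #|Q| = 2%N by apply/eqP; rewrite eqn_leq Q2 (compatible_card S0 CS0 cQ).
  by rewrite /karger_bound -[2%:R - 1]/(1 + 1 - 1 : R) addrK mulr1 divff ?lexx ?pnatr_eq0.
- move=> Q cQ Q2; have [partQ _] := cQ.
  have Q0 : 2 < #|Q|%:R :> R by rewrite ltr_nat.
  have := min_cut_remaining loopless_ends partQ w_ge0 minC (ltnW Q2).
  set T := total w (remaining ends Q) => QT.
  have QC : 0 < #|Q|%:R * total w C by apply: mulr_gt0 => //; lra.
  have T0 : 0 < T by lra.
  split=> //; rewrite karger_boundS // ler_wpM2r //.
    by apply: karger_bound_ge0; rewrite -ltnS prednK // ltnW // ltnW.
  rewrite lerD2l lerN2 ler_pdivrMr // mulrAC ler_pdivlMr; last by lra.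
  by rewrite mulrC.
- exact: leq_trans (compatible_card_le cP) (leq_addl _ _).
Qed.

Lemma pred_eta_total : \sum_(e in C) (1 - p e) * w e = eta * total w C.
Proof. by rewrite /pred_eta divfK ?lt0r_neq0. Qed.

Lemma pred_rho_total : \sum_(e in ~: C) p e * w e = rho * total w C.
Proof. by rewrite /pred_rho divfK ?lt0r_neq0. Qed.

Lemma pred_eta_itv : 0 <= eta <= 1.
Proof.
apply/andP; split.
  apply: divr_ge0; last exact: total_ge0.
  by apply: sumr_ge0 => e _; have := p01 e; have := w_ge0 e; nra.
rewrite /pred_eta ler_pdivrMr // mul1r; apply: ler_sum => e _.
by have := p01 e; have := w_ge0 e; nra.
Qed.

Lemma total_boosted_cut B :
  total (boosted B w p) C = (1 + (B - 1) * eta) * total w C.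
Proof.
rewrite mulrDl mul1r -mulrA -pred_eta_total /total mulr_sumr -big_split /=.
by apply: eq_bigr => e _; rewrite /boosted; ring.
Qed.

(** The boosted weight is B w - (B - 1) p w, and the sum of p w is at most w(C) on C and equals rho
    w(C) off C. *)
Lemma total_boosted_ge B F : 1 <= B ->
  B * total w F - (B - 1) * (1 + rho) * total w C <= total (boosted B w p) F.
Proof.
move=> B1; rewrite -mulrA [(1 + rho) * _]mulrDl mul1r -pred_rho_total.
have -> : total (boosted B w p) F =
          B * total w F - (B - 1) * \sum_(e in F) p e * w e.
  rewrite /total !mulr_sumr -sumrB.
  by apply: eq_bigr => e _; rewrite /boosted; ring.
rewrite lerD2l lerN2 ler_wpM2l ?subr_ge0 //.
apply: le_trans (_ : \sum_e p e * w e <= _).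
  rewrite [leRHS](bigID (mem F)) /= lerDl.
  by apply: sumr_ge0 => e _; have /andP[? _] := p01 e; rewrite mulr_ge0.
rewrite (bigID (mem C)) /=; apply: lerD.
  apply: ler_sum => e _; have /andP[_ p1] := p01 e.
  by rewrite ler_piMl.
by under [leRHS]eq_bigl do rewrite in_setC.
Qed.

Lemma boosted_contraction P (n : nat) : compatible S P -> (0 < n)%N ->
  2 * rho + 2 < #|P|%:R ->
  let wB := boosted n.+1%:R w p in
  0 < total wB (remaining ends P) /\
  total wB C / total wB (remaining ends P) <=
    2 * (eta + n%:R^-1) / (#|P|%:R - (2 * rho + 2)).
Proof.
move=> cP n0 Prho /=; have [partP _] := cP.
have nR : 0 < n%:R :> R by rewrite ltr0n.
have B1 : 1 <= n.+1%:R :> R by rewrite ler1n.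
have := min_cut_remaining loopless_ends partP w_ge0 minC (compatible_card S0 CS0 cP).
have := total_boosted_ge (remaining ends P) B1.
rewrite total_boosted_cut -natr1 addrK.
set T := total (boosted _ _ _) (remaining _ _); set U := total w (remaining _ _).
set W := total w C; have W0 : 0 < W := C_gt0.
set m : R := #|P|%:R in Prho *; move=> TU mU.
have x0 : 0 < m - (2 * rho + 2) by lra.
have nW : 0 < n%:R * W by exact: mulr_gt0.
(* With B = n + 1, one copy of U >= 0 is dropped so that n W factors out of the bound. *)
have Tx : n%:R * W * (m - (2 * rho + 2)) <= 2 * T.
  have U0 : 0 <= U by exact: total_ge0.
  have : n%:R * (m * W) <= n%:R * (2 * U) by rewrite ler_wpM2l // ltW.
  by move: TU; nra.
have T0 : 0 < T by have := mulr_gt0 nW x0; lra.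
split=> //; rewrite ler_pdivrMr // mulrAC ler_pdivlMr //.
have /andP[e0 _] := pred_eta_itv.
have -> : (1 + n%:R * eta) * W = (eta + n%:R^-1) * (n%:R * W).
  by field; rewrite lt0r_neq0.
rewrite -mulrA [leRHS](_ : _ = (eta + n%:R^-1) * (2 * T)); last by ring.
by rewrite ler_wpM2l // addr_ge0 // invr_ge0 ltW.
Qed.

(** Phase 1 is run on the cut with boosted weights; [karger_success] bounds its test function, the
    success probability of Phase 2. *)
Lemma boosted_karger_success (n t : nat) : (1 < n)%N -> (1 < t)%N ->
  1 <= rho -> 3 * rho + 5 <= t%:R ->
  boosted_bound t (2 * (eta + n%:R^-1)) (2 * rho + 5) #|V| <=
  prob (boosted_karger ends w p n.+1%:R t) (is_min_cut ends w).
Proof.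
move=> n1 t1 r0 tr; rewrite prob_expect /boosted_karger expect_dbind.
rewrite -(card_singletons V).
have /andP[e0 e1] := pred_eta_itv.
have nR : 2 <= n%:R :> R by rewrite ler_nat.
have nV0 : 0 <= n%:R^-1 :> R by rewrite invr_ge0; lra.
have nV1 : n%:R^-1 <= 2^-1 :> R by rewrite lef_pV2 ?posrE; lra.
have wB0 e : 0 <= boosted n.+1%:R w p e.
  rewrite /boosted mulr_ge0 // -natr1 addrK addr_ge0 // mulr_ge0 //.
  by have := p01 e; lra.
apply: (expect_contract_while_ge loopless_ends) (compatible_singletons S) _ => //.
- move=> Q; rewrite expect_dbind.
  by apply: expect_contract_while_ge0 => // P; rewrite expect_dret.
- move=> Q cQ Qt; rewrite expect_dbind /boosted_bound Qt.
  apply: le_trans (karger_success cQ) _.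
  by rewrite /expect; apply: ler_sum => P _; rewrite -/(expect _ _) expect_dret.
- move=> Q cQ tQ; have tQR : t%:R + 1 <= #|Q|%:R :> R by rewrite natr1 ler_nat.
  have [|T0 ratio] := boosted_contraction cQ (ltnW n1); first by lra.
  set s := 2 * (eta + n%:R^-1) in ratio *; set d := 2 * rho + 5.
  split=> //; apply: le_trans (_ : (1 - s / (#|Q|%:R - (2 * rho + 2))) *
                                   boosted_bound t s d #|Q|.-1 <= _).
    (* Here eta <= 1 and 1/n <= 1/2 give s <= 3, exactly the gap between d = 2 rho + 5 and the shift
       2 rho + 2 in the contraction bound. *)
    by apply: boosted_boundS => //; rewrite /s /d; [exact: ltnW|lra|lra|lra].
  rewrite ler_wpM2r ?lerD2l ?lerN2 // /boosted_bound.
  case: ifP => _; last by rewrite mulr_ge0 ?powR_ge0 // karger_bound_ge0 // ltnW.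
  by apply: karger_bound_ge0; rewrite -ltnS prednK (leq_trans _ tQ) // ltnW.
- by rewrite card_singletons leq_addl.
Qed.

End BoostedKarger.

(** * Choice of the parameters and conclusion *)

Theorem theorem1 (R : realType) :
  exists c : R, 0 < c /\
  exists (B : nat -> R -> R -> R) (t : nat -> R -> R -> nat),
    (forall (n : nat) (eta rho : R),
       1 <= B n eta rho /\ (2 <= t n eta rho)%N) /\
    forall (V E : finType) (ends : E -> {set V}) (w p : E -> R) (C : {set E}),
      loopless ends ->
      (forall e : E, 0 <= w e) ->
      (forall e : E, 0 <= p e <= 1) ->
      is_min_cut ends w C ->
      let n := #|V| in
      let eta := pred_eta w p C in
      let rho := pred_rho w p C in
      1 <= rho ->
      c / (powR n%:R (2 * eta) * powR rho (2 * (1 - eta))) <=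
      prob (boosted_karger ends w p (B n eta rho) (t n eta rho))
           (is_min_cut ends w).
Proof.
exists 162^-1; split; first by rewrite invr_gt0.
(* Truncation loses less than 1, so adding 6 places t between 3 rho + 5 and 3 rho + 6. *)
exists (fun n _ _ => n.+1%:R), (fun _ _ rho => (Num.truncn (3 * rho) + 6)%N).
split=> [n eta rho|V E ends w p C ll w0 p01 minC n eta rho r1].
  by rewrite ler1n addnC.
have /andP[/existsP[S /and3P[S0 CS0 /eqP CE]] _] := minC.
have W0 : 0 < total w C.
  rewrite lt_neqAle total_ge0 // andbT; apply/negP => /eqP W.
  by move: r1; rewrite /rho /pred_rho -W invr0 mulr0 ler10.
(* Both sides of the cut are nonempty, so the partition into singletons has at least two blocks. *)
have n2 : (1 < n)%N.
  by rewrite /n -(card_singletons V) (compatible_card S0 CS0 (compatible_singletons S)).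
have e01 : 0 <= eta <= 1 by rewrite /eta CE pred_eta_itv // -CE.
have r0 : 0 <= 3 * rho by lra.
have t1 := truncn_le (3 * rho); have t2 := truncnS_gt (3 * rho).
set t := (_ + 6)%N; have tR : 3 * rho + 5 <= t%:R <= 3 * rho + 6.
  by rewrite /t natrD; move: t1 t2; rewrite r0 -natr1 => t1 t2; lra.
apply: le_trans (boosted_bound_ge n2 r1 e01 tR) _.
rewrite /eta /rho CE; apply: boosted_karger_success => //; rewrite -?CE //.
- by rewrite /t addnC.
- by case/andP: tR.
Qed.
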